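(* Let $R$ be a ring and let $n$ be a positive integer. Then the following are equivalent. (1) $R$ is central reduced. (2) The polynomial ring $R[x_1,x_2,\ldots,x_n]$ is central reduced. (3) The power series ring $R[[x_1,x_2,\ldots,x_n]]$ is central reduced. (4) The Laurent polynomial ring $R[x_1,x_1^{-1},x_2,x_2^{-1},\ldots,x_n,x_n^{-1}]$ is central reduced.
   Context: All rings are associative with identity, not necessarily commutative. A ring $R$ is called central reduced if every nilpotent element of $R$ is central, i.e. commutes with every element of $R$. The indeterminates commute with each other and with the coefficients. *)

(* Defs.v *)
From HB Require Import structures.
From mathcomp Require Import all_boot all_order all_algebra.
From mathcomp Require Import finmap.
From mathcomp Require Import boolp.
From mathcomp Require Import monalg.
From mathcomp Require mpoly.
Set Implicit Arguments.
Unset Strict Implicit.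
Unset Printing Implicit Defensive.

Import GRing.Theory.
Local Open Scope ring_scope.

Definition central_reduced (S : pzRingType) : Prop :=
  forall a : S, (exists2 k, (0 < k)%N & a ^+ k = 0) ->
  forall b : S, GRing.comm a b.

(* The ring R[M] of finitely supported formal sums over a commutative monoid M,
   written additively.  monalg makes {malg R[K]} a ring only when R is
   nontrivial and 1 is the only unit of K, which rules out the trivial ring as
   well as the monomials of Laurent polynomials. *)
Definition monoid_ring (M : nmodType) (R : pzRingType) : Type := {malg R[M]}.

Section MonoidRing.
Variables (M : nmodType) (R : pzRingType).
Local Open Scope fset_scope.
Local Notation MR := {malg R[M]}.

Implicit Types (g : MR) (k : M).

Definition mr_monom (c : R) (k : M) : MR := mkmalgU k c.
Definition mr_one : MR := mr_monom 1 0.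
Definition mr_mul g1 g2 : MR :=
  \sum_(k1 <- msupp g1) \sum_(k2 <- msupp g2)
    mr_monom (g1@_k1 * g2@_k2) (k1 + k2).

Lemma mr_mulw (d1 d2 : {fset M}) g1 g2 :
  msupp g1 `<=` d1 -> msupp g2 `<=` d2 ->
  mr_mul g1 g2 = \sum_(k1 <- d1) \sum_(k2 <- d2)
    mr_monom (g1@_k1 * g2@_k2) (k1 + k2).
Proof.
move=> le_d1 le_d2; rewrite /mr_mul (big_fset_incl _ le_d1) /=.
  apply/eq_bigr=> k1 _; apply/big_fset_incl => // k _ /mcoeff_outdom ->.
  by rewrite mulr0 /mr_monom monalgU0.
move=> k _ /mcoeff_outdom g1k.
by rewrite big1 => // k' _; rewrite g1k mul0r /mr_monom monalgU0.
Qed.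

Lemma mr_coefM g1 g2 k :
  (mr_mul g1 g2)@_k = \sum_(k1 <- msupp g1) \sum_(k2 <- msupp g2)
    (g1@_k1 * g2@_k2) *+ (k1 + k2 == k).
Proof.
rewrite /mr_mul raddf_sum; apply: eq_bigr => k1 _.
by rewrite /= raddf_sum; apply: eq_bigr => k2 _; rewrite /= /mr_monom mcoeffU.
Qed.

Lemma mr_monomM c1 c2 k1 k2 :
  mr_mul (mr_monom c1 k1) (mr_monom c2 k2) = mr_monom (c1 * c2) (k1 + k2).
Proof.
by rewrite (mr_mulw msuppU_le msuppU_le) !big_seq_fset1 !mcoeffUU.
Qed.

Lemma mr_mul0g : left_zero 0 mr_mul.
Proof. by move=> g; rewrite /mr_mul msupp0 big_seq_fset0. Qed.

Lemma mr_mulg0 : right_zero 0 mr_mul.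
Proof.
by move=> g; rewrite /mr_mul big1 // => k _; rewrite msupp0 big_seq_fset0.
Qed.

Lemma mr_mul1g : left_id mr_one mr_mul.
Proof.
move=> g; rewrite (mr_mulw msuppU_le (fsubset_refl _)) big_seq_fset1.
rewrite [RHS]monalgE; apply: eq_bigr => k _.
by rewrite mcoeffUU mul1r add0r.
Qed.

Lemma mr_mulg1 : right_id mr_one mr_mul.
Proof.
move=> g; rewrite (mr_mulw (fsubset_refl _) msuppU_le).
rewrite [RHS]monalgE; apply: eq_bigr => k _.
by rewrite big_seq_fset1 mcoeffUU mulr1 addr0.
Qed.

Lemma mr_mulDl : left_distributive mr_mul +%R.
Proof.
move=> g1 g2 g; have le := fsubset_refl (msupp g).
rewrite (mr_mulw (msuppD_le _ _) le).
rewrite (mr_mulw (fsubsetUl (msupp g1) (msupp g2)) le).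
rewrite (mr_mulw (fsubsetUr (msupp g1) (msupp g2)) le).
rewrite -big_split /=; apply/eq_bigr=> k1 _.
rewrite -big_split /=; apply/eq_bigr=> k2 _.
by rewrite /mr_monom mcoeffD mulrDl monalgUD.
Qed.

Lemma mr_mulDr : right_distributive mr_mul +%R.
Proof.
move=> g g1 g2; have le := fsubset_refl (msupp g).
rewrite (mr_mulw le (msuppD_le _ _)).
rewrite (mr_mulw le (fsubsetUl (msupp g1) (msupp g2))).
rewrite (mr_mulw le (fsubsetUr (msupp g1) (msupp g2))).
rewrite -big_split /=; apply/eq_bigr=> k1 _.
rewrite -big_split /=; apply/eq_bigr=> k2 _.
by rewrite /mr_monom mcoeffD mulrDr monalgUD.
Qed.

Lemma mr_mul_suml (I : Type) (r : seq I) (F : I -> MR) g :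
  mr_mul (\sum_(i <- r) F i) g = \sum_(i <- r) mr_mul (F i) g.
Proof.
exact: (big_morph (mr_mul^~ g) (fun _ _ => mr_mulDl _ _ _) (mr_mul0g _)).
Qed.

Lemma mr_mul_sumr (I : Type) (r : seq I) (F : I -> MR) g :
  mr_mul g (\sum_(i <- r) F i) = \sum_(i <- r) mr_mul g (F i).
Proof.
exact: (big_morph (mr_mul g) (fun _ _ => mr_mulDr _ _ _) (mr_mulg0 _)).
Qed.

Lemma mr_mulA : associative mr_mul.
Proof.
move=> g1 g2 g3.
rewrite [g1]monalgE !mr_mul_suml; apply: eq_bigr => k1 _.
rewrite [g2]monalgE mr_mul_suml !mr_mul_sumr mr_mul_suml; apply: eq_bigr => k2 _.
rewrite [g3]monalgE !mr_mul_sumr; apply: eq_bigr => k3 _.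
by rewrite !mr_monomM mulrA addrA.
Qed.

HB.instance Definition _ := GRing.Zmodule.on (monoid_ring M R).
HB.instance Definition _ := GRing.Zmodule_isPzRing.Build (monoid_ring M R)
  mr_mulA mr_mul1g mr_mulg1 mr_mulDl mr_mulDr.

End MonoidRing.

(* The exponents of x_1, ..., x_n are functions 'I_n -> nat.  For a nontrivial
   ring R this is the ring {mpoly R[n]}: mvpoly_of_mpoly below is an
   isomorphism. *)
Definition mvpoly (n : nat) (R : pzRingType) : Type :=
  monoid_ring {ffun 'I_n -> nat} R.
HB.instance Definition _ n R := GRing.PzRing.on (mvpoly n R).

Definition laurent (n : nat) (R : pzRingType) : Type :=
  monoid_ring {ffun 'I_n -> int} R.
HB.instance Definition _ n R := GRing.PzRing.on (laurent n R).

(* The pairs (a, b) with a + b = m, without repetition: mem_mexp_splits and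
   mexp_splits_uniq. *)
Definition mexp_splits (n : nat) (m : {ffun 'I_n -> nat}) :
    seq ({ffun 'I_n -> nat} * {ffun 'I_n -> nat}) :=
  [seq ([ffun i => k i : nat], [ffun i => (m i - k i)%N])
     | k : {dffun forall i : 'I_n, 'I_(m i).+1}].

Lemma mem_mexp_splits n (m a b : {ffun 'I_n -> nat}) :
  ((a, b) \in mexp_splits m) = (a + b == m).
Proof.
apply/imageP/eqP => [[k _ [-> ->]]|/= <-] /=.
  by apply/ffunP => i; rewrite !ffunE; apply: subnKC; rewrite -ltnS.
have lt i : (a i < ((a + b)%R i).+1)%N by rewrite ffunE ltnS; apply: leq_addr.
pose k : {dffun forall i : 'I_n, 'I_((a + b)%R i).+1} :=
  [ffun i => Ordinal (lt i)].
have kE i : k i = a i :> nat by exact: (congr1 val (ffunE _ i)).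
exists k => //; congr pair; apply/ffunP => i; rewrite [RHS]ffunE kE //.
by rewrite ffunE; symmetry; apply: addKn.
Qed.

Lemma mexp_splits_uniq n (m : {ffun 'I_n -> nat}) : uniq (mexp_splits m).
Proof.
rewrite map_inj_uniq ?enum_uniq // => k1 k2 [/ffunP eq_k _].
by apply/ffunP => i; apply/val_inj; have := eq_k i; rewrite !ffunE.
Qed.

(* The coefficient family is arbitrary, with no support condition. *)
Record mvpseries (n : nat) (R : pzRingType) : Type :=
  MVPSeries { ps_coef : {ffun 'I_n -> nat} -> R }.

Section PowerSeries.
Variables (n : nat) (R : pzRingType).
Local Notation PS := (mvpseries n R).
Local Notation N := {ffun 'I_n -> nat}.

HB.instance Definition _ := [isNew for @ps_coef n R].
HB.instance Definition _ := [Choice of PS by <:].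

Implicit Types (f g h : PS) (m : N).

Lemma mvpseriesP f g : (forall m, ps_coef f m = ps_coef g m) -> f = g.
Proof. by move=> eq_fg; apply/val_inj/functional_extensionality_dep. Qed.

Definition ps_zero : PS := MVPSeries (fun=> 0).
Definition ps_opp f : PS := MVPSeries (fun m => - ps_coef f m).
Definition ps_add f g : PS := MVPSeries (fun m => ps_coef f m + ps_coef g m).
Definition ps_one : PS := MVPSeries (fun m => (m == 0)%:R).
Definition ps_mul f g : PS :=
  MVPSeries (fun m => \sum_(p <- mexp_splits m) ps_coef f p.1 * ps_coef g p.2).

Lemma ps_addA : associative ps_add.
Proof. by move=> f g h; apply/mvpseriesP => m /=; rewrite addrA. Qed.
Lemma ps_addC : commutative ps_add.
Proof. by move=> f g; apply/mvpseriesP => m /=; rewrite addrC. Qed.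
Lemma ps_add0 : left_id ps_zero ps_add.
Proof. by move=> f; apply/mvpseriesP => m /=; rewrite add0r. Qed.
Lemma ps_addN : left_inverse ps_zero ps_opp ps_add.
Proof. by move=> f; apply/mvpseriesP => m /=; rewrite addNr. Qed.

HB.instance Definition _ :=
  GRing.isZmodule.Build PS ps_addA ps_addC ps_add0 ps_addN.

Lemma ps_mulA : associative ps_mul.
Proof.
move=> f g h; apply/mvpseriesP => m /=.
pose F (t : N * N * N) :=
  ps_coef f t.1.1 * ps_coef g t.1.2 * ps_coef h t.2.
pose sl := [seq (p.1, q.1, q.2) | p <- mexp_splits m, q <- mexp_splits p.2].
pose sr := [seq (q.1, q.2, p.2) | p <- mexp_splits m, q <- mexp_splits p.1].
have -> : \sum_(p <- mexp_splits m) ps_coef f p.1 *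
    (\sum_(q <- mexp_splits p.2) ps_coef g q.1 * ps_coef h q.2)
    = \sum_(t <- sl) F t.
  rewrite big_allpairs_dep; apply: eq_bigr => p _.
  by rewrite mulr_sumr; apply: eq_bigr => q _; rewrite mulrA.
have -> : \sum_(p <- mexp_splits m)
    (\sum_(q <- mexp_splits p.1) ps_coef f q.1 * ps_coef g q.2) *
      ps_coef h p.2 = \sum_(t <- sr) F t.
  rewrite big_allpairs_dep; apply: eq_bigr => p _.
  by rewrite mulr_suml.
apply: perm_big; apply: uniq_perm.
- apply: allpairs_uniq_dep => [|p _|]; rewrite ?mexp_splits_uniq //.
  move=> _ _ /allpairsPdep[p [q [_ qp ->]]] /allpairsPdep[p' [q' [_ qp' ->]]].
  case: p q p' q' qp qp' => [a b] [c d] [a' b'] [c' d'] /=.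
  rewrite !mem_mexp_splits /= => /eqP qp /eqP qp' [ea ec ed].
  by rewrite -qp -qp' ea ec ed.
- apply: allpairs_uniq_dep => [|p _|]; rewrite ?mexp_splits_uniq //.
  move=> _ _ /allpairsPdep[p [q [_ qp ->]]] /allpairsPdep[p' [q' [_ qp' ->]]].
  case: p q p' q' qp qp' => [a b] [c d] [a' b'] [c' d'] /=.
  rewrite !mem_mexp_splits /= => /eqP qp /eqP qp' [ea ec ed].
  by rewrite -qp -qp' ea ec ed.
- move=> [[a b] c]; apply/allpairsPdep/allpairsPdep.
    move=> [[x y] [[z w] /= []]]; rewrite !mem_mexp_splits
      => /eqP pm /eqP qp [-> -> ->].
    exists (x + z, w), (x, z); rewrite !mem_mexp_splits /= eqxx.
    by rewrite -addrA qp pm eqxx.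
  move=> [[x y] [[z w] /= []]]; rewrite !mem_mexp_splits
      => /eqP pm /eqP qp [-> -> ->].
  exists (z, w + y), (w, y); rewrite !mem_mexp_splits /= eqxx.
  by rewrite addrA qp pm eqxx.
Qed.

Lemma ps_mul1 : left_id ps_one ps_mul.
Proof.
move=> f; apply/mvpseriesP => m /=.
rewrite (bigD1_seq (0, m)) ?mem_mexp_splits ?mexp_splits_uniq ?add0r //=.
rewrite eqxx mul1r big_seq_cond big1 ?addr0 // => -[a b].
rewrite mem_mexp_splits /= => /andP[/eqP <-].
by case: (eqVneq a 0) => [->|_ _]; rewrite ?add0r ?eqxx // mul0r.
Qed.

Lemma ps_mulr1 : right_id ps_one ps_mul.
Proof.
move=> f; apply/mvpseriesP => m /=.
rewrite (bigD1_seq (m, 0)) ?mem_mexp_splits ?mexp_splits_uniq ?addr0 //=.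
rewrite eqxx mulr1 big_seq_cond big1 ?addr0 // => -[a b].
rewrite mem_mexp_splits /= => /andP[/eqP <-].
by case: (eqVneq b 0) => [->|_ _]; rewrite ?addr0 ?eqxx // mulr0.
Qed.

Lemma ps_mulDl : left_distributive ps_mul +%R.
Proof.
move=> f g h; apply/mvpseriesP => m /=; rewrite -big_split /=.
by apply: eq_bigr => p _; rewrite mulrDl.
Qed.

Lemma ps_mulDr : right_distributive ps_mul +%R.
Proof.
move=> f g h; apply/mvpseriesP => m /=; rewrite -big_split /=.
by apply: eq_bigr => p _; rewrite mulrDr.
Qed.

HB.instance Definition _ := GRing.Zmodule_isPzRing.Build PS
  ps_mulA ps_mul1 ps_mulr1 ps_mulDl ps_mulDr.

End PowerSeries.

Import (canonicals, coercions) mpoly.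

Section MvpolyMpoly.
Variables (n : nat) (R : nzRingType).

Definition mexp_of (m : mpoly.multinom n) : {ffun 'I_n -> nat} :=
  [ffun i => mpoly.fun_of_multinom m i].
Definition mnm_of (m : {ffun 'I_n -> nat}) : mpoly.multinom n :=
  mpoly.Multinom [tuple m i | i < n].

Lemma mexp_ofK : cancel mexp_of mnm_of.
Proof. by move=> m; apply/mpoly.mnmP => i; rewrite mpoly.mnmE ffunE. Qed.

Lemma mnm_ofK : cancel mnm_of mexp_of.
Proof. by move=> m; apply/ffunP => i; rewrite ffunE mpoly.mnmE. Qed.

Lemma mexp_ofD m1 m2 :
  mexp_of (mpoly.mnm_add m1 m2) = mexp_of m1 + mexp_of m2.
Proof. by apply/ffunP => i; rewrite !ffunE mpoly.mnmDE. Qed.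

Definition mvpoly_of_mpoly (p : mpoly.mpoly n R) : mvpoly n R :=
  \sum_(m <- mpoly.msupp p) mr_monom (mpoly.mcoeff m p) (mexp_of m).

Lemma mcoeff_mvpoly_of_mpoly p m :
  (mvpoly_of_mpoly p : {malg R[_]})@_(mexp_of m) = mpoly.mcoeff m p.
Proof.
rewrite /mvpoly_of_mpoly raddf_sum /=.
under eq_bigr => k _ do rewrite mcoeffU (can_eq mexp_ofK).
have [m_p|/[dup] Nm_p /mpoly.memN_msupp_eq0 ->] := boolP (m \in mpoly.msupp p).
  rewrite (bigD1_seq m) ?mpoly.msupp_uniq //= eqxx mulr1n big1 ?addr0 // => k.
  by move=> /negbTE->.
rewrite big_seq big1 // => k; case: eqVneq => // -> m_p.
by rewrite m_p in Nm_p.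
Qed.

Lemma mvpoly_of_mpoly_bij : bijective mvpoly_of_mpoly.
Proof.
pose psi (g : {malg R[{ffun 'I_n -> nat}]}) : mpoly.mpoly n R :=
  \sum_(k <- msupp g) g@_k *: mpoly.mpolyX R (mnm_of k).
have psiE g m : mpoly.mcoeff m (psi g) = g@_(mexp_of m).
  rewrite /psi raddf_sum /=.
  under eq_bigr => k _ do
    rewrite mpoly.mcoeffZ mpoly.mcoeffX (can2_eq mnm_ofK mexp_ofK).
  have [m_g|/[dup] Nm_g /mcoeff_outdom ->] := boolP (mexp_of m \in msupp g).
    rewrite (bigD1_seq (mexp_of m)) ?fset_uniq //= eqxx mulr1 big1 ?addr0 //.
    by move=> k /negbTE->; rewrite mulr0.
  rewrite big_seq big1 // => k; case: eqVneq => [->|_ _]; last by rewrite mulr0.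
  by move=> m_g; rewrite m_g in Nm_g.
exists psi => [p|g].
  by apply/mpoly.mpolyP => m; rewrite psiE mcoeff_mvpoly_of_mpoly.
by apply/malgP => k; rewrite -[k]mnm_ofK mcoeff_mvpoly_of_mpoly psiE.
Qed.

Lemma mvpoly_of_mpolyD : {morph mvpoly_of_mpoly : p q / p + q}.
Proof.
move=> p q; apply/malgP => k; rewrite -[k]mnm_ofK mcoeffD.
by rewrite !mcoeff_mvpoly_of_mpoly mpoly.mcoeffD.
Qed.

Lemma mvpoly_of_mpoly1 : mvpoly_of_mpoly 1 = 1.
Proof.
apply/malgP => k; rewrite -[k]mnm_ofK mcoeff_mvpoly_of_mpoly mpoly.mcoeff1.
rewrite [1 in RHS]/(mr_one _ _) mcoeffU eq_sym -(can_eq mexp_ofK).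
by congr ((_ == _)%:R); apply/ffunP => i; rewrite ffunE mpoly.mnm0E ffunE.
Qed.

Lemma mvpoly_of_mpolyM : {morph mvpoly_of_mpoly : p q / p * q}.
Proof.
move=> p q; rewrite mpoly.mpolyME.
have phi0 : mvpoly_of_mpoly 0 = 0.
  by apply/malgP => k; rewrite -[k]mnm_ofK mcoeff_mvpoly_of_mpoly
    mpoly.mcoeff0 mcoeff0.
rewrite (big_morph _ mvpoly_of_mpolyD phi0) big_allpairs /=.
transitivity (mr_mul (mvpoly_of_mpoly p) (mvpoly_of_mpoly q)); last by [].
rewrite [mvpoly_of_mpoly p]/mvpoly_of_mpoly mr_mul_suml; apply: eq_bigr => m1 _.
rewrite [mvpoly_of_mpoly q]/mvpoly_of_mpoly mr_mul_sumr; apply: eq_bigr => m2 _.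
rewrite mr_monomM -mexp_ofD; apply/malgP => k.
rewrite -[k]mnm_ofK mcoeff_mvpoly_of_mpoly mpoly.mcoeffZ mpoly.mcoeffX.
by rewrite mcoeffU (can_eq mexp_ofK) mulr_natr.
Qed.

End MvpolyMpoly.

(* Main.v *)
(* The nilpotent elements of a central reduced ring form a radical two-sided
   ideal N.  Let f^k = 0 for a power series or Laurent polynomial f, and order
   the exponents lexicographically.  If a is the least exponent with f_a not in
   N, then the coefficient of f^k at k a is congruent to f_a^k modulo N, whence
   f_a is in N, a contradiction.  So all the coefficients of f are nilpotent,
   hence central, and f is central.  Conversely the property descends to
   subrings. *)
Require Import Defs.
From mathcomp Require Import all_boot all_order all_algebra.
From mathcomp Require Import finmap boolp monalg zify.

Set Implicit Arguments.
Unset Strict Implicit.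
Unset Printing Implicit Defensive.

Import Order.TTheory GRing.Theory Num.Theory.
Local Open Scope ring_scope.

Definition nilpotent_elt (S : pzRingType) (a : S) : Prop :=
  exists2 k, (0 < k)%N & a ^+ k = 0.

(** * Nilpotent elements of a central reduced ring *)

Section Nilpotents.
Variable R : pzRingType.
Implicit Types a b : R.

Lemma nilpotent_elt0 : nilpotent_elt (0 : R).
Proof. by exists 1%N. Qed.

Lemma nilpotent_eltD a b : GRing.comm a b ->
  nilpotent_elt a -> nilpotent_elt b -> nilpotent_elt (a + b).
Proof.
move=> ab [k k0 ak] [l l0 bl]; exists (k + l)%N; first by rewrite addn_gt0 k0.
(* In each binomial term either [b] has exponent at least [l] or [a] has exponent at least [k]. *)
rewrite exprDn_comm // big1 // => i _; have [le_li|lt_il] := leqP l i.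
  by rewrite -(subnKC le_li) exprD bl mul0r mulr0 mul0rn.
have -> : (k + l - i = k + (l - i))%N by lia.
by rewrite exprD ak !mul0r mul0rn.
Qed.

Lemma nilpotent_eltM a b : GRing.comm a b ->
  nilpotent_elt a -> nilpotent_elt (a * b).
Proof. by move=> ab [k k0 ak]; exists k; rewrite // exprMn_comm // ak mul0r. Qed.

Lemma nilpotent_eltX a k : (0 < k)%N ->
  nilpotent_elt (a ^+ k) -> nilpotent_elt a.
Proof.
by move=> k0 [l l0 akl]; exists (k * l)%N; rewrite ?muln_gt0 ?k0 // exprM.
Qed.

Hypothesis R_cr : central_reduced R.

Lemma cr_nilpotentD a b :
  nilpotent_elt a -> nilpotent_elt b -> nilpotent_elt (a + b).
Proof. by move=> na nb; apply: nilpotent_eltD => //; apply: R_cr. Qed.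

Lemma cr_nilpotentMr a b : nilpotent_elt a -> nilpotent_elt (a * b).
Proof. by move=> na; apply: nilpotent_eltM => //; apply: R_cr. Qed.

Lemma cr_nilpotentMl a b : nilpotent_elt b -> nilpotent_elt (a * b).
Proof. by move=> nb; rewrite -(R_cr nb a); apply: cr_nilpotentMr. Qed.

Lemma cr_nilpotentN a : nilpotent_elt a -> nilpotent_elt (- a).
Proof. by rewrite -mulrN1; apply: cr_nilpotentMr. Qed.

Lemma cr_nilpotent_sum (I : eqType) (s : seq I) (P : pred I) (F : I -> R) :
  (forall i, i \in s -> P i -> nilpotent_elt (F i)) ->
  nilpotent_elt (\sum_(i <- s | P i) F i).
Proof.
move=> nF; rewrite big_seq_cond; elim/big_ind: _ => [||i /andP[]].
- exact: nilpotent_elt0.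
- exact: cr_nilpotentD.
- exact: nF.
Qed.

End Nilpotents.

(** [phi] respects positive powers, so it carries nilpotents to nilpotents; commutation in [T] is
    pulled back by injectivity. *)
Lemma central_reduced_inj (S T : pzRingType) (phi : S -> T) :
  injective phi -> phi 0 = 0 -> {morph phi : x y / x * y} ->
  central_reduced T -> central_reduced S.
Proof.
move=> phi_inj phi0 phiM T_cr a [[//|k] _ ak] b; apply: phi_inj.
rewrite !phiM; apply: T_cr; exists k.+1 => //.
suff <- : phi (a ^+ k.+1) = phi a ^+ k.+1 by rewrite ak.
by elim: k {ak} => // k IH; rewrite exprS phiM IH -exprS.
Qed.

(** * The lexicographic order on Z^n *)

Section Lex.
Variable n : nat.
Implicit Types u v x y : {ffun 'I_n -> int}.

Definition lex u v : Prop :=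
  exists2 i, u i < v i & forall j : 'I_n, (j < i)%N -> u j = v j.

(** Look at the first index [j] where the two pairs differ. There the sums satisfy a weak
    inequality, so one of the summands must be strictly smaller. *)
Lemma lex_sum u v x y : (u, v) <> (x, y) ->
  u + v = x + y \/ lex (u + v) (x + y) -> lex u x \/ lex v y.
Proof.
move=> neq le_uv.
pose d (j : 'I_n) := (u j != x j) || (v j != y j).
have [j0 dj0] : exists j, d j.
  apply/existsP; apply: contra_notT neq; rewrite negb_exists => /forallP eq.
  by congr pair; apply/ffunP => j; have := eq j; rewrite negb_or !negbK;
    case/andP => /eqP ? /eqP ?.
case: (arg_minnP (fun j : 'I_n => nat_of_ord j) dj0) => j dj min_j.
have eq_lt (i : 'I_n) : (i < j)%N -> u i = x i /\ v i = y i.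
  move=> lt_ij; have : ~~ d i by apply/negP => /min_j; rewrite leqNgt lt_ij.
  by rewrite negb_or !negbK => /andP[/eqP -> /eqP ->].
(* The sums agree at every index before [j], so a first strict inequality between them occurs at [j]
   or later. *)
have le_j : u j + v j <= x j + y j.
  case: le_uv => [/ffunP/(_ j)|[i lt_i eq_i]]; first by rewrite !ffunE => ->.
  have [lt_ij|] := ltnP i j.
    by have [ui vi] := eq_lt _ lt_ij; move: lt_i; rewrite !ffunE ui vi ltxx.
  rewrite leq_eqVlt => /orP[/eqP/val_inj ->|/eq_i]; last by rewrite !ffunE => ->.
  by move: lt_i; rewrite !ffunE => /ltW.
have [lt_u|lt_v] : u j < x j \/ v j < y j by move: dj; rewrite /d; lia.
- by left; exists j => // i /eq_lt[].
- by right; exists j => // i /eq_lt[].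
Qed.

(** The order is not well founded on Z^n; the common lower bound [B] allows the coordinates to be
    minimised one after another. *)
Lemma lex_min (A : {ffun 'I_n -> int} -> Prop) (B : int) :
  (exists u, A u) -> (forall u, A u -> forall i, B <= u i) ->
  exists2 u, A u & forall v, A v -> ~ lex v u.
Proof.
move=> exA lbA.
(* Induction on [k]: no element of [A] lies below [u] with its first difference at an index less
   than [k]. *)
suff: forall k, (k <= n)%N -> exists2 u, A u & forall v, A v ->
    forall i : 'I_n, (i < k)%N -> v i < u i ->
    ~ (forall j : 'I_n, (j < i)%N -> v j = u j).
  move=> /(_ n (leqnn n))[u Au min_u]; exists u => // v Av [i lt_i eq_i].
  exact: (min_u v Av i (ltn_ord i) lt_i eq_i).
elim=> [_|k IH lt_kn]; first by case: exA => u Au; exists u.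
have [u Au min_u] := IH (ltnW lt_kn); pose i0 := Ordinal lt_kn.
pose Q v := A v /\ forall j : 'I_n, (j < k)%N -> v j = u j.
(* The excess of coordinate [k] over [B] is a natural number, hence has a least value among the
   elements agreeing with [u] before [k]. *)
have exQ : exists m, `[< exists2 v, Q v & v i0 = B + Posz m >].
  exists `|u i0 - B|%N; apply/asboolP; exists u; first by split.
  by have := lbA _ Au i0; lia.
case: (ex_minnP exQ) => m /asboolP[v [Av eq_v] vm] min_m.
exists v => // w Aw i; rewrite ltnS leq_eqVlt => /orP[/eqP ik|lt_ik] lt_w eq_w.
  have ii0 : i = i0 by exact/val_inj.
  have Qw : Q w by split=> // j lt_jk; rewrite eq_w ?ik ?eq_v.
  have : (m <= `|w i0 - B|)%N.
    apply: min_m; apply/asboolP; exists w => //.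
    by have := lbA _ Aw i0; lia.
  by have := lbA _ Aw i0; move: lt_w; rewrite ii0; lia.
apply: (min_u w Aw i lt_ik) => [|j lt_ji]; first by rewrite -eq_v.
by rewrite eq_w // eq_v // (ltn_trans lt_ji).
Qed.

End Lex.

(** * Leading coefficients modulo nilpotents *)

(* [c f m] is the coefficient of [f] at [m], and [e] embeds the exponents
   into Z^n. *)
Section NilpotentCoefficients.
Variables (n : nat) (M : nmodType) (e : M -> {ffun 'I_n -> int}).
Variables (R S : pzRingType) (c : S -> M -> R).
Hypothesis e_inj : injective e.
Hypothesis eD : {morph e : a b / a + b}.
Hypothesis c0 : forall m, c 0 m = 0.
(** An exponent in Z^n has infinitely many splittings, so the finite list [s] may omit those whose
    product of coefficients vanishes. *)
Hypothesis cM : forall f g m, exists s : seq (M * M),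
  [/\ uniq s, forall p, p \in s -> p.1 + p.2 = m,
      forall a b, a + b = m -> (a, b) \notin s -> c f a * c g b = 0
    & c (f * g) m = \sum_(p <- s) c f p.1 * c g p.2].
Hypothesis c_lb : forall f, exists B : int,
  forall m, c f m <> 0 -> forall i, B <= e m i.
Hypothesis R_cr : central_reduced R.

Definition nil_below f a := forall p, lex (e p) (e a) -> nilpotent_elt (c f p).

(** By [lex_sum], [p] is below [a] or [q] is below [b], so one factor is nilpotent, and the
    nilpotents form an ideal. *)
Lemma nil_below_term f g a b p q : nil_below f a -> nil_below g b ->
  (p, q) <> (a, b) -> p + q = a + b \/ lex (e (p + q)) (e (a + b)) ->
  nilpotent_elt (c f p * c g q).
Proof.
move=> fa gb neq le_pq.
have [||/fa nf|/gb ng] := @lex_sum n (e p) (e q) (e a) (e b).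
- by move=> [/e_inj eq_p /e_inj eq_q]; apply: neq; rewrite eq_p eq_q.
- by rewrite -!eD; case: le_pq => [->|]; [left|right].
- exact: cr_nilpotentMr.
- exact: cr_nilpotentMl.
Qed.

(** Leading terms multiply modulo nilpotents: the splitting [(a, b)] is the only one at or below
    [a + b] that can contribute a non-nilpotent product. *)
Lemma nil_belowM f g a b : nil_below f a -> nil_below g b ->
  nil_below (f * g) (a + b) /\
  nilpotent_elt (c (f * g) (a + b) - c f a * c g b).
Proof.
move=> fa gb; split.
  move=> m lt_m; have [s [_ s_m _ ->]] := cM f g m.
  apply: cr_nilpotent_sum => // -[p q] /s_m /= def_m _; subst m.
  apply: (nil_below_term fa gb); last by right.
  move=> [ep eq]; move: lt_m; rewrite ep eq => -[i].
  by rewrite ltxx.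
have [s [s_uniq s_m s_supp ->]] := cM f g (a + b).
have nil_rest : nilpotent_elt
    (\sum_(p <- s | p != (a, b)) c f p.1 * c g p.2).
  apply: cr_nilpotent_sum => // -[p q] /s_m /= eq_pq /eqP neq.
  by apply: (nil_below_term fa gb) => //; left.
(* If [s] omits [(a, b)], then [c f a * c g b] is zero and the remaining terms are the whole sum. *)
have [abs|Nabs] := boolP ((a, b) \in s).
  by rewrite (bigD1_seq (a, b)) //= addrAC subrr add0r.
rewrite s_supp // subr0; move: nil_rest; congr nilpotent_elt.
rewrite big_seq_cond [RHS]big_seq; apply: eq_bigl => p.
by case: eqVneq => [->|]; rewrite ?andbT // (negbTE Nabs).
Qed.

Lemma nil_belowX f a k : nil_below f a ->
  nil_below (f ^+ k.+1) (a *+ k.+1) /\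
  nilpotent_elt (c (f ^+ k.+1) (a *+ k.+1) - c f a ^+ k.+1).
Proof.
move=> fa; elim: k => [|k [IHb IHn]].
  by rewrite !expr1 mulr1n subrr; split=> //; apply: nilpotent_elt0.
have [lb ln] := nil_belowM fa IHb.
rewrite (exprS f k.+1) (mulrS a k.+1) (exprS _ k.+1); split=> //.
(* Insert the intermediate product: the first difference is nilpotent by [nil_belowM], the second is
   a multiple of the nilpotent from the induction hypothesis. *)
rewrite -[X in X - _](subrK (c f a * c (f ^+ k.+1) (a *+ k.+1))) -addrA -mulrBr.
by apply: cr_nilpotentD => //; apply: cr_nilpotentMl.
Qed.

Lemma nilpotent_coef f : nilpotent_elt f -> forall m, nilpotent_elt (c f m).
Proof.
move=> [[//|k] _ fk] m; apply: contrapT => nm; have [B lbB] := c_lb f.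
(* A non-nilpotent coefficient is nonzero, so the bound from [c_lb] applies to [A]. *)
pose A u := exists2 p, u = e p & ~ nilpotent_elt (c f p).
have [|_ [p -> np] i|_ [a -> na] min_a] := @lex_min n A B.
- by exists (e m), m.
- by apply: lbB => fp; apply: np; rewrite fp; apply: nilpotent_elt0.
apply: na; have [|_] := @nil_belowX f a k.
  by move=> p lt_p; apply: contrapT => np; apply: (min_a (e p)) => //; exists p.
rewrite fk c0 sub0r => /(cr_nilpotentN R_cr); rewrite opprK.
exact: nilpotent_eltX.
Qed.

End NilpotentCoefficients.

(** * Monoid rings *)

Section MonoidRing.
Variables (M : nmodType) (R : pzRingType).
Local Notation MR := {malg R[M]}.

Lemma mr_coefM_splits (f g : MR) m : exists s : seq (M * M),
  [/\ uniq s, forall p, p \in s -> p.1 + p.2 = m,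
      forall a b, a + b = m -> (a, b) \notin s -> f@_a * g@_b = 0
    & (mr_mul f g)@_m = \sum_(p <- s) f@_p.1 * g@_p.2].
Proof.
exists [seq p <- [seq (a, b) | a <- msupp f, b <- msupp g] | p.1 + p.2 == m].
split.
- by rewrite filter_uniq // allpairs_uniq ?fset_uniq // => -[? ?] [? ?].
- by move=> p; rewrite mem_filter => /andP[/eqP].
- move=> a b eq_m; rewrite mem_filter /= eq_m eqxx /=; apply: contraNeq => fg.
  apply: allpairs_f; rewrite -mcoeff_neq0; apply: contraNneq fg => ->.
    by rewrite mul0r.
  by rewrite mulr0.
rewrite mr_coefM big_filter [RHS]big_mkcond big_allpairs /=.
by apply: eq_bigr => a _; apply: eq_bigr => b _; rewrite mulrb.
Qed.

Lemma mr_mulC_coef (f g : MR) :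
  (forall a b, GRing.comm f@_a g@_b) -> mr_mul f g = mr_mul g f.
Proof.
move=> fg; apply/malgP => m; rewrite !mr_coefM exchange_big /=.
by apply: eq_bigr => b _; apply: eq_bigr => a _; rewrite fg addrC.
Qed.

Lemma central_reduced_monoid_ring n (e : M -> {ffun 'I_n -> int}) :
  injective e -> {morph e : a b / a + b} ->
  central_reduced R -> central_reduced (monoid_ring M R).
Proof.
move=> e_inj eD R_cr f nf g; apply: mr_mulC_coef => a b.
apply: (R_cr); move: f nf a.
apply: (nilpotent_coef (S := monoid_ring M R) (c := fun h m => (h : MR)@_m)
  e_inj eD) => //.
- exact: mcoeff0.
- exact: mr_coefM_splits.
(* The finite support gives a crude bound: minus the sum of the absolute values of all coordinates
   of its exponents. *)
move=> f; exists (- \sum_(m <- msupp f) \sum_i `|e m i|) => m /eqP fm i.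
have m_f : m \in msupp f by rewrite -mcoeff_neq0.
rewrite (bigD1_seq m) ?fset_uniq //= (bigD1 i) //= lerNl -addrA.
rewrite (le_trans (ler_norm _)) // normrN lerDl addr_ge0 // sumr_ge0 // => k _.
by rewrite sumr_ge0.
Qed.

Lemma central_reduced_of_monoid_ring :
  central_reduced (monoid_ring M R) -> central_reduced R.
Proof.
apply: (@central_reduced_inj R (monoid_ring M R) (fun r => mr_monom r 0)).
- by move=> r s /(congr1 (mcoeff 0)); rewrite !mcoeffUU.
- exact: monalgU0.
- by move=> r s; rewrite [RHS]mr_monomM addr0.
Qed.

End MonoidRing.

(** * Power series rings *)

Section PowerSeries.
Variables (n : nat) (R : pzRingType).
Local Notation PS := (mvpseries n R).

Definition exp_int (m : {ffun 'I_n -> nat}) : {ffun 'I_n -> int} :=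
  [ffun i => Posz (m i)].

Lemma exp_int_inj : injective exp_int.
Proof.
by move=> a b /ffunP eq; apply/ffunP => i; have := eq i; rewrite !ffunE => -[].
Qed.

Lemma exp_intD : {morph exp_int : a b / a + b}.
Proof. by move=> a b; apply/ffunP => i; rewrite !ffunE. Qed.

Lemma ps_mulC_coef (f g : PS) :
  (forall a b, GRing.comm (ps_coef f a) (ps_coef g b)) -> f * g = g * f.
Proof.
move=> fg; apply: mvpseriesP => m /=.
pose sw (p : {ffun 'I_n -> nat} * {ffun 'I_n -> nat}) := (p.2, p.1).
have sw_inj : injective sw by move=> [? ?] [? ?] [-> ->].
(* Exchanging the two components permutes the splittings of [m]. *)
transitivity (\sum_(p <- map sw (mexp_splits m)) ps_coef g p.1 * ps_coef f p.2).
  by rewrite [RHS]big_map; apply: eq_bigr => p _; apply: fg.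
apply: perm_big; apply: uniq_perm; rewrite ?mexp_splits_uniq //.
  by rewrite map_inj_uniq ?mexp_splits_uniq.
move=> [a b]; have -> : (a, b) = sw (b, a) by [].
by rewrite mem_map // !mem_mexp_splits addrC.
Qed.

Lemma central_reduced_mvpseries :
  central_reduced R -> central_reduced (mvpseries n R).
Proof.
move=> R_cr f nf g; apply: ps_mulC_coef => a b; apply: (R_cr); move: f nf a.
apply: (nilpotent_coef exp_int_inj exp_intD (c := @ps_coef n R)) => //.
- move=> f g' m; exists (mexp_splits m); split=> //.
  + exact: mexp_splits_uniq.
  + by move=> [a c]; rewrite mem_mexp_splits => /eqP.
  + by move=> a c eq_m; rewrite mem_mexp_splits eq_m eqxx.
(* The exponents are natural numbers, so zero bounds them even when the support is infinite. *)
- by move=> f; exists 0 => m _ i; rewrite ffunE.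
Qed.

Lemma central_reduced_of_mvpseries :
  central_reduced (mvpseries n R) -> central_reduced R.
Proof.
pose C r : PS := MVPSeries (fun m => r *+ (m == 0)).
apply: (@central_reduced_inj R PS C).
- by move=> r s /(congr1 (fun f => ps_coef f 0)); rewrite /= eqxx.
- by apply: mvpseriesP => m /=; rewrite mul0rn.
move=> r s; apply: mvpseriesP => m /=.
(* [C r] vanishes away from exponent zero, so only the splitting [(0, m)] contributes. *)
rewrite (bigD1_seq (0, m)) ?mem_mexp_splits ?mexp_splits_uniq ?add0r //=.
rewrite eqxx mulrnAr big_seq_cond big1 ?addr0 // => -[a b].
rewrite mem_mexp_splits /= => /andP[/eqP <-].
by case: (eqVneq a 0) => [->|_ _]; rewrite ?add0r ?eqxx // mulr0n mul0r.
Qed.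

End PowerSeries.

Theorem theorem2p24 (R : pzRingType) (n : nat) (hn : (0 < n)%N) :
  [<-> central_reduced R;
       central_reduced (mvpoly n R);
       central_reduced (mvpseries n R);
       central_reduced (laurent n R)].
Proof.
(* The implications form a cycle; those between two extensions pass through [R]. *)
tfae.
- exact: central_reduced_monoid_ring (@exp_int_inj n) (@exp_intD n).
- by move=> /central_reduced_of_monoid_ring; apply: central_reduced_mvpseries.
- move=> /central_reduced_of_mvpseries.
  (* Laurent exponents already lie in Z^n, so the embedding is the identity. *)
  exact: (@central_reduced_monoid_ring _ _ n id).
- exact: central_reduced_of_monoid_ring.
Qed.
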